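(* Let $d>1$, $e>1$, $n\ge 2$, and let $w\in G(de,e,n)$. Then the word $RE(w)$ is a reduced expression over $\mathbf{X}$ of $w$.
   Context: For $m\ge1$ let $\zeta_m=\exp(2\pi i/m)$. $G(de,e,n)$ is the group of $n\times n$ monomial matrices whose nonzero entries are $de$-th roots of unity and such that the product of the nonzero entries is a $d$-th root of unity. Generators: $z=\mathrm{Diag}(\zeta_d,1,\dots,1)$; for $i\in\mathbb{Z}/de\mathbb{Z}$, $t_i$ is the block diagonal matrix with upper-left $2\times2$ block $\begin{pmatrix}0&\zeta_{de}^{-i}\\ \zeta_{de}^{i}&0\end{pmatrix}$ and lower-right block $I_{n-2}$; for $3\le j\le n$, $s_j$ is the permutation matrix of the transposition $(j-1,j)$. Let $X=\{z,t_0,\dots,t_{de-1},s_3,\dots,s_n\}$ and let $\mathbf{X}=\{\mathbf{z},\mathbf{t}_0,\dots,\mathbf{t}_{de-1},\mathbf{s}_3,\dots,\mathbf{s}_n\}$ be the corresponding alphabet of formal letters; put $\mathbf{s}_2:=\mathbf{t}_0$. A word over $\mathbf{X}$ is a finite sequence of letters of $\mathbf{X}$ (no inverses); it represents $w$ if the product of the corresponding matrices is $w$. A reduced expression over $\mathbf{X}$ of $w$ is a word over $\mathbf{X}$ representing $w$ of minimal length among all such words. The word $RE(w)$: put $w_n:=w$. For $i=n,n-1,\dots,2$, $w_i$ is an $i\times i$ monomial matrix; let $c$ be the unique column with $w_i[i,c]\neq0$. Then $w_{i-1}$ is obtained from $w_i$ by removing row $i$ and column $c$, and then multiplying the first column of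 the resulting matrix by $w_i[i,c]$. Then $w_1=\zeta_d^k$ for a unique $0\le k\le d-1$, and $RE_1(w):=\mathbf{z}^k$. For $2\le i\le n$: if $w_i[i,c]=1$, then $RE_i(w):=\mathbf{s}_i\mathbf{s}_{i-1}\cdots\mathbf{s}_{c+1}$ (decreasing indices, empty if $c=i$). If $w_i[i,c]=\zeta_{de}^k$ with $1\le k\le de-1$, then $RE_i(w)$ is $\mathbf{s}_i\cdots\mathbf{s}_3\mathbf{t}_k$ if $c=1$; $\mathbf{s}_i\cdots\mathbf{s}_3\mathbf{t}_k\mathbf{t}_0$ if $c=2$; $\mathbf{s}_i\cdots\mathbf{s}_3\mathbf{t}_k\mathbf{t}_0\mathbf{s}_3\cdots\mathbf{s}_c$ if $c\ge3$. Here $\mathbf{s}_i\cdots\mathbf{s}_3$ has decreasing indices and is empty when $i=2$; $\mathbf{z}^0$ is the empty word. Finally $RE(w):=RE_1(w)RE_2(w)\cdots RE_n(w)$. *)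

(* Defs.v *)
From HB Require Import structures.
From mathcomp Require Import all_boot all_order all_algebra.
From mathcomp Require Import reals trigo complex.

Set Implicit Arguments.
Unset Strict Implicit.
Unset Printing Implicit Defensive.

Import Order.TTheory GRing.Theory Num.Theory.

Local Open Scope ring_scope.

(* exp (2 i pi / m), by Euler's formula. *)
Definition zeta (R : realType) (m : nat) : R[i] :=
  Complex (cos (2 * pi / m%:R)) (sin (2 * pi / m%:R)).

Definition is_monomial (K : fieldType) (n : nat) (w : 'M[K]_n) : Prop :=
  (forall i, exists! j, w i j != 0) /\ (forall j, exists! i, w i j != 0).

Definition in_G (R : realType) (d e n : nat) (w : 'M[R[i]]_n) : Prop :=
  [/\ is_monomial w,
      forall i j, w i j != 0 -> (d * e).-unity_root (w i j)
    & d.-unity_root (\prod_i \prod_(j | w i j != 0) w i j)].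

(* Lt k stands for t_k, where k in Z/de is represented by 0 <= k < de, and Ls j
   for s_j; the bounds on k and j are imposed by [alphabet]. *)
Inductive letter := Lz | Lt of nat | Ls of nat.

Definition alphabet (d e n : nat) (l : letter) : bool :=
  match l with
  | Lz => true
  | Lt k => (k < d * e)%N
  | Ls j => (3 <= j <= n)%N
  end.

(* s_j, with the additional convention s_2 := t_0. *)
Definition s_letter (j : nat) : letter := if j == 2 then Lt 0 else Ls j.

(* The matrices are only meaningful for n >= 2; smaller sizes get a dummy
   value. *)
Definition z_mx (R : realType) (d n : nat) : 'M[R[i]]_n :=
  diag_mx (\row_j (if j == 0 :> nat then zeta R d else 1)).

Definition t_block (K : fieldType) (a : K) : 'M[K]_2 :=
  block_mx 0 a^-1%:M a%:M (0 : 'M_1).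

Definition t_mx (R : realType) (d e n k : nat) : 'M[R[i]]_n :=
  match n return 'M[R[i]]_n with
  | n'.+2 => block_mx (t_block (zeta R (d * e) ^+ k)) 0 0 (1%:M : 'M_n')
  | _ => 1%:M
  end.

(* The transposition (j-1, j) of {1, ..., n} is (j-2, j-1) on 'I_n. *)
Definition s_mx (R : realType) (n j : nat) : 'M[R[i]]_n :=
  match n return 'M[R[i]]_n with
  | n'.+1 => tperm_mx (inord j.-2) (inord j.-1)
  | 0 => 1%:M
  end.

Definition letter_mx (R : realType) (d e n : nat) (l : letter) : 'M[R[i]]_n :=
  match l with
  | Lz => z_mx R d n
  | Lt k => t_mx R d e n k
  | Ls j => s_mx R n j
  end.

Definition represents (R : realType) (d e n : nat) (u : seq letter)
    (w : 'M[R[i]]_n) : Prop :=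
  all (alphabet d e n) u /\ \prod_(l <- u) letter_mx R d e n l = w.

Definition reduced_expression (R : realType) (d e n : nat) (u : seq letter)
    (w : 'M[R[i]]_n) : Prop :=
  represents d e u w /\
  forall v : seq letter, represents d e v w -> (size u <= size v)%N.

(* The exponent 0 <= k < m such that a = zeta_m ^ k (0 if there is none). *)
Definition zeta_log (R : realType) (m : nat) (a : R[i]) : nat :=
  if [pick k : 'I_m | zeta R m ^+ k == a] is Some k then k else 0%N.

Definition last_row_col (K : fieldType) (m : nat) (w : 'M[K]_m.+1) : 'I_m.+1 :=
  odflt ord0 [pick c | w ord_max c != 0].

(* The passage from w_i to w_(i-1), for i = m + 2. *)
Definition reduce_mx (K : fieldType) (m : nat) (w : 'M[K]_m.+2) : 'M[K]_m.+1 :=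
  let c := last_row_col w in
  let w' : 'M[K]_m.+1 := row' ord_max (col' c w) in
  \matrix_(i, j) (if j == ord0 then w ord_max c * w' i j else w' i j).

Definition s_up (a b : nat) : seq letter :=
  [seq s_letter j | j <- index_iota a b.+1].

Definition s_down (b a : nat) : seq letter := rev (s_up a b).

(* RE_i for i >= 2, where c is the column number counted from 1 and a is the
   entry w_i[i, c]. *)
Definition RE_step (R : realType) (d e i c : nat) (a : R[i]) : seq letter :=
  if a == 1 then s_down i c.+1
  else
    let k := zeta_log (d * e) a in
    if c == 1%N then s_down i 3 ++ [:: Lt k]
    else if c == 2%N then s_down i 3 ++ [:: Lt k; Lt 0]
    else s_down i 3 ++ [:: Lt k; Lt 0] ++ s_up 3 c.

(* The word RE_1 ... RE_(m+1) of an (m + 1) x (m + 1) matrix. *)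
Fixpoint RE_rec (R : realType) (d e m : nat) : 'M[R[i]]_m.+1 -> seq letter :=
  match m return 'M[R[i]]_m.+1 -> seq letter with
  | 0 => fun w => nseq (zeta_log d (w ord0 ord0)) Lz
  | m'.+1 => fun w =>
      let c := last_row_col w in
      RE_rec d e (reduce_mx w) ++ RE_step d e m'.+2 c.+1 (w ord_max c)
  end.

Definition RE (R : realType) (d e n : nat) : 'M[R[i]]_n -> seq letter :=
  match n return 'M[R[i]]_n -> seq letter with
  | 0 => fun _ => [::]
  | m.+1 => fun w => RE_rec d e w
  end.

(* Main.v *)
Require Import Defs.
From HB Require Import structures.
From mathcomp Require Import all_boot all_order all_algebra.
From mathcomp Require Import reals trigo complex.
From mathcomp Require Import zify lra.

(* Rows of a monomial matrix are pairs (column, coefficient), on which words act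
   from the right.  The word RE(w) sends the i-th basis vector to the i-th row of
   w, by induction on the size.  For minimality, RE is empty on the identity, so
   it is enough that multiplying w on the left by a letter lengthens RE(w) by at
   most 1.  The length of RE_i is i - c or i + c - 2, according to whether the
   entry is 1 or not.  A letter s_j exchanges two consecutively processed rows;
   removing both leaves the same matrix in either order, so only RE_j and
   RE_(j-1) change.  Likewise a letter t_k only changes RE_2, since it preserves
   the product of the nonzero entries, and z only changes RE_1. *)

Set Implicit Arguments.
Unset Strict Implicit.
Unset Printing Implicit Defensive.

Import Order.TTheory GRing.Theory Num.Theory.

Local Open Scope ring_scope.

(** * Primitive roots of unity and their logarithms *)

Lemma zeta_expr (R : realType) (m k : nat) :
  zeta R m ^+ k =
  Complex (cos ((2 * pi / m%:R) *+ k)) (sin ((2 * pi / m%:R) *+ k)).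
Proof.
elim: k => [|k IHk]; first by rewrite !mulr0n cos0 sin0.
rewrite exprSr IHk !(mulrSr _ k) cosD sinD (addrC (sin _ * _)).
by rewrite [LHS]/GRing.mul.
Qed.

Lemma zeta_prim (R : realType) (m : nat) :
  (0 < m)%N -> m.-primitive_root (zeta R m).
Proof.
move=> m_gt0; have m_neq0 : m%:R != 0 :> R by rewrite pnatr_eq0 -lt0n.
rewrite /primitive_root_of_unity m_gt0; apply/forallP=> i; apply/eqP.
rewrite unity_rootE zeta_expr; have [->|nei] := eqVneq i.+1 m.
  rewrite -[X in cos X]mulr_natr -[X in sin X]mulr_natr divfK //.
  by rewrite mulrC mulr_natr cos2pi sin2pi; apply/eqP.
have lt_i : (i.+1 < m)%N by rewrite ltn_neqAle nei ltn_ord.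
apply/negbTE/eqP => -[cos1 _]; move: cos1.
(* [y] is half the angle. It lies strictly between 0 and pi, where the sine is positive, whereas cos
   (2 y) = 1 forces sin y = 0. *)
set y : R := (pi / m%:R) *+ i.+1.
have -> : (2 * pi / m%:R) *+ i.+1 = y *+ 2.
  by rewrite /y -mulrA mulr_natl -!mulrnA mulnC.
rewrite cos_mulr2n cos2sin2 => cos1.
have : 0 < sin y.
  apply: sin_gt0_pi; rewrite /y -mulr_natr mulr_gt0 ?divr_gt0 ?pi_gt0 ?ltr0n //=.
  by rewrite mulrAC ltr_pdivrMr ?ltr0n // ltr_pM2l ?pi_gt0 // ltr_nat.
suff -> : sin y = 0 by rewrite ltxx.
by apply/eqP; rewrite -sqrf_eq0; apply/eqP; lra.
Qed.

Lemma zeta_logK (R : realType) (m : nat) (a : R[i]) :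
  (0 < m)%N -> a ^+ m = 1 -> zeta R m ^+ zeta_log m a = a.
Proof.
move=> m_gt0 am1; rewrite /zeta_log; case: pickP => [k /eqP //|noa].
have [k ak] := prim_rootP (zeta_prim R m_gt0) am1.
by move: (noa k); rewrite ak eqxx.
Qed.

Lemma zeta_log_lt (R : realType) (m : nat) (a : R[i]) :
  (0 < m)%N -> (zeta_log m a < m)%N.
Proof. by rewrite /zeta_log; case: pickP. Qed.

Lemma zeta_log_expr (R : realType) (m k : nat) :
  (k < m)%N -> zeta_log m (zeta R m ^+ k) = k.
Proof.
move=> lt_km; have prim := zeta_prim R (leq_ltn_trans (leq0n k) lt_km).
rewrite /zeta_log; case: pickP => [j|/(_ (Ordinal lt_km))]; last by rewrite eqxx.
by rewrite (eq_prim_root_expr prim) !modn_small // => /eqP.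
Qed.

Lemma zeta_neq0 (R : realType) (m : nat) : (0 < m)%N -> zeta R m != 0.
Proof.
move=> m_gt0; apply: contra_eq_neq (prim_expr_order (zeta_prim R m_gt0)) => ->.
by rewrite expr0n eqn0Ngt m_gt0 eq_sym oner_neq0.
Qed.

Lemma zeta_log_mulz (R : realType) (m : nat) (a : R[i]) : (0 < m)%N ->
  (zeta_log m (zeta R m * a)%R <= (zeta_log m a).+1)%N.
Proof.
(* A logarithm 0 on the left, genuine or by default, is trivial. If it is j + 1, cancelling one
   factor zeta shows that [a] is zeta ^ j, of logarithm j. *)
move=> m_gt0; rewrite {1}/zeta_log; case: pickP => // -[[|j] lt_j] //=.
rewrite exprS => /eqP /(mulfI (zeta_neq0 R m_gt0)) <-.
by rewrite zeta_log_expr // ltnW.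
Qed.

(** * Monomial matrices as functions on rows, and removal of the last row *)

Definition scale_row (K : fieldType) (b : K) (p : nat * K) : nat * K :=
  (p.1, b * p.2).

(* The row (c, a) stands for a times the c-th basis vector, columns being
   counted from 0. *)
Definition monomial_mx (K : fieldType) (m : nat) (f : nat -> nat * K) :
    'M[K]_m.+1 :=
  \matrix_(i, j) (if j == (f i).1 :> nat then (f i).2 else 0).

Definition comp_rows (K : fieldType) (f g : nat -> nat * K) (i : nat) :=
  scale_row (f i).2 (g (f i).1).

(** What becomes of the row [q] when the last row [p] and its column are removed: columns are
    renumbered by [unbump], and the coefficient of [p] is absorbed by the row lying in the new first
    column. *)
Definition reduce_row (K : fieldType) (p q : nat * K) : nat * K :=
  (unbump p.1 q.1, if unbump p.1 q.1 == 0%N then p.2 * q.2 else q.2).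

(** Indices are natural numbers constrained only up to [m], so that one function can serve at
    successive sizes. *)
Record monomial_rows (K : fieldType) (m : nat) (f : nat -> nat * K) : Prop :=
  MonomialRows {
    rows_le : forall i, (i <= m)%N -> ((f i).1 <= m)%N;
    rows_neq0 : forall i, (i <= m)%N -> (f i).2 != 0;
    rows_inj : forall i j, (i <= m)%N -> (j <= m)%N ->
      (f i).1 = (f j).1 -> i = j }.

Lemma eq_monomial_mx (K : fieldType) (m : nat) (f g : nat -> nat * K) :
  (forall i, (i <= m)%N -> f i = g i) -> monomial_mx m f = monomial_mx m g.
Proof. by move=> eq_fg; apply/matrixP=> i j; rewrite !mxE eq_fg // -ltnS. Qed.

Lemma mulmx_monomial (K : fieldType) (m : nat) (f g : nat -> nat * K) :
  monomial_rows m f ->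
  monomial_mx m f *m monomial_mx m g = monomial_mx m (comp_rows f g).
Proof.
move=> f_mon; apply/matrixP=> i j; rewrite !mxE.
have le_i : (i <= m)%N by rewrite -ltnS.
rewrite (bigD1 (Ordinal (rows_le f_mon le_i : ((f i).1 < m.+1)%N))) //=.
rewrite !mxE /= eqxx big1 ?addr0 => [|k nek].
  by case: ifP => _; rewrite ?mulr0.
rewrite !mxE (_ : (_ == _) = false) ?mul0r //.
by apply/negbTE; apply: contra nek => /eqP kE; apply/eqP/val_inj.
Qed.

Lemma comp_monomial_rows (K : fieldType) (m : nat) (f g : nat -> nat * K) :
  monomial_rows m f -> monomial_rows m g -> monomial_rows m (comp_rows f g).
Proof.
move=> [f_le f_neq0 f_inj] [g_le g_neq0 g_inj].
split=> [i le_i|i le_i|i j le_i le_j] /=.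
- by apply: g_le; apply: f_le.
- by rewrite mulf_neq0 ?f_neq0 ?g_neq0 ?f_le.
- by move=> /g_inj => /(_ (f_le _ le_i) (f_le _ le_j)) /f_inj; apply.
Qed.

Lemma reduce_monomial_rows (K : fieldType) (m : nat) (f : nat -> nat * K) :
  monomial_rows m.+1 f -> monomial_rows m (reduce_row (f m.+1) \o f).
Proof.
move=> [f_le f_neq0 f_inj].
have ne i : (i <= m)%N -> (f i).1 <> (f m.+1).1.
  by move=> le_i /(f_inj _ _ (leqW le_i) (leqnn _)) eqi; rewrite eqi ltnn in le_i.
split=> [i le_i|i le_i|i j le_i le_j] /=.
- have := f_le _ (leqW le_i); have := f_le m.+1 (leqnn _); have := ne _ le_i.
  rewrite /unbump; lia.
- by case: ifP => _; rewrite ?mulf_neq0 ?f_neq0 // leqW.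
- move=> eq_ij; apply: f_inj; rewrite ?leqW //.
  have := ne _ le_i; have := ne _ le_j; move: eq_ij.
  by rewrite /unbump; lia.
Qed.

Lemma last_row_col_monomial (K : fieldType) (m : nat) (f : nat -> nat * K) :
  monomial_rows m f -> last_row_col (monomial_mx m f) = (f m).1 :> nat.
Proof.
move=> [f_le f_neq0 _]; rewrite /last_row_col.
have lt_f : ((f m).1 < m.+1)%N := f_le _ (leqnn m).
case: pickP => [c|/(_ (Ordinal lt_f))] /=; last by rewrite mxE /= eqxx f_neq0.
by rewrite mxE /=; case: ifP => [/eqP //|_]; rewrite eqxx.
Qed.

Lemma monomial_mx_last (K : fieldType) (m : nat) (f : nat -> nat * K) :
  monomial_rows m f ->
  monomial_mx m f ord_max (last_row_col (monomial_mx m f)) = (f m).2.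
Proof. by move=> f_mon; rewrite mxE last_row_col_monomial // eqxx. Qed.

Lemma reduce_monomial_mx (K : fieldType) (m : nat) (f : nat -> nat * K) :
  monomial_rows m.+1 f ->
  reduce_mx (monomial_mx m.+1 f) = monomial_mx m (reduce_row (f m.+1) \o f).
Proof.
move=> f_mon; apply/matrixP=> i j.
rewrite mxE monomial_mx_last // !mxE /= last_row_col_monomial //.
have -> : bump m.+1 i = i by rewrite /bump; have := ltn_ord i; lia.
have /eqP ne : (f i).1 != (f m.+1).1.
  have lti := ltn_ord i; apply/eqP => /(rows_inj f_mon (ltnW lti) (leqnn _)) eqi.
  by rewrite eqi ltnn in lti.
(* [bump] and [unbump] are mutually inverse away from the removed column, which row i avoids. *)
have -> : (bump (f m.+1).1 j == (f i).1) = (j == unbump (f m.+1).1 (f i).1 :> nat).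
  by rewrite /bump /unbump; lia.
have -> : (j == ord0) = (j == 0%N :> nat) by [].
by case: (eqVneq (j : nat) (unbump _ _)) => [->|_]; rewrite // mulr0 if_same.
Qed.

(** The columns of the reduced rows form a permutation [s], so exactly one row lies in the first
    column and the removed coefficient is absorbed exactly once. *)
Lemma prod_reduce_row (K : fieldType) (m : nat) (f : nat -> nat * K) :
  monomial_rows m.+1 f ->
  \prod_(i < m.+1) (reduce_row (f m.+1) (f i)).2 = \prod_(i < m.+2) (f i).2.
Proof.
move=> f_mon; have [g_le _ g_inj] := reduce_monomial_rows f_mon.
pose s (i : 'I_m.+1) : 'I_m.+1 := Ordinal (g_le i (ltn_ord i) : (_ < m.+1)%N).
have s_inj : injective s.
  by move=> i j /(congr1 val) /g_inj eq_ij; apply/val_inj/eq_ij; rewrite -ltnS.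
rewrite [RHS]big_ord_recr [RHS]mulrC.
transitivity (\prod_(i < m.+1) ((if s i == ord0 then (f m.+1).2 else 1) * (f i).2)).
  apply: eq_bigr => i _; rewrite -[s i == _]/(unbump _ _ == 0%N) /=.
  by case: ifP; rewrite ?mul1r.
rewrite big_split; congr (_ * _).
transitivity (\prod_(i < m.+1 | i == ord0) (f m.+1).2); last by rewrite big_pred1_eq.
by rewrite -big_mkcond [RHS](reindex_inj s_inj).
Qed.


Lemma unbump_eq0 (h k : nat) : h <> k ->
  (unbump h k == 0%N) = (k == 0%N) || ((h == 0%N) && (k == 1%N)).
Proof. rewrite /unbump; lia. Qed.

(* Processing two rows in either order leaves the same rows: both coefficients
   end up in the first remaining column. *)
Lemma reduce_rowC (K : fieldType) (p q r : nat * K) :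
  p.1 <> q.1 -> p.1 <> r.1 -> q.1 <> r.1 ->
  reduce_row (reduce_row p q) (reduce_row p r) =
  reduce_row (reduce_row q p) (reduce_row q r).
Proof.
case: p q r => [c a] [c' a'] [x b] /= ne1 ne2 ne3.
have unbumpC :
    unbump (unbump c c') (unbump c x) = unbump (unbump c' c) (unbump c' x).
  rewrite /unbump; lia.
have ne1' : c' <> c by move/esym.
rewrite /reduce_row /= unbumpC; congr pair.
(* If the row does not end in column 0, it was not there after a single removal either, and its
   coefficient stays [b] in both orders. *)
case: eqP => u0; last first.
  rewrite !unbump_eq0 //.
  have [-> ->] : (x == 0%N) || (c == 0%N) && (x == 1%N) = false /\
      (x == 0%N) || (c' == 0%N) && (x == 1%N) = false.
    by move: u0; rewrite /unbump; lia.
  by [].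
(* If it ends in column 0, only the values 0, 1 and at least 2 of the three columns matter; each
   possible case gives the product of the three coefficients. *)
rewrite !unbump_eq0 //; move: u0; rewrite /unbump.
clear unbumpC.
case: c c' x ne1 ne2 ne3 {ne1'} => [|[|c]] [|[|c']] [|[|x]] //= _ _ _ u0.
all: by [rewrite ?mulrA // (mulrC a' a) | exfalso; lia].
Qed.

(** * Action of letters and words on rows *)

Definition letter_row (R : realType) (d e : nat) (l : letter) (x : nat) :
    nat * R[i] :=
  match l with
  | Lz => (x, if x == 0%N then zeta R d else 1)
  | Lt k => match x with
            | 0 => (1%N, (zeta R (d * e) ^+ k)^-1)
            | 1 => (0%N, zeta R (d * e) ^+ k)
            | _ => (x, 1)
            end
  | Ls j => (if x == j.-2 then j.-1 else if x == j.-1 then j.-2 else x, 1)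
  end.

Definition word_row (R : realType) (d e : nat) (u : seq letter)
    (p : nat * R[i]) : nat * R[i] :=
  foldl (fun q l => scale_row q.2 (letter_row R d e l q.1)) p u.

Definition word_rows (R : realType) (d e : nat) (u : seq letter) (i : nat) :
    nat * R[i] :=
  word_row d e u (i, 1).

(* In size 1 the matrices of the t_k have a dummy value. *)
Definition letter_ok (d e m : nat) (l : letter) : bool :=
  alphabet d e m.+1 l && (if l is Lt _ then (0 < m)%N else true).

Lemma letter_monomial_rows (R : realType) (d e m : nat) (l : letter) :
  (0 < d)%N -> (0 < e)%N -> letter_ok d e m l ->
  monomial_rows m (letter_row R d e l).
Proof.
move=> d_gt0 e_gt0; have de_gt0 : (0 < d * e)%N by rewrite muln_gt0 d_gt0.
case: l => [|k|j] /andP[/= okl okm]; split => [i|i|i j' _ _]; rewrite /=.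
- by [].
- by case: ifP; rewrite ?zeta_neq0 ?oner_neq0.
- by [].
- by case: i => [|[|i]].
- by case: i => [|[|i]] _ /=; rewrite ?invr_eq0 ?expf_neq0 ?zeta_neq0 ?oner_neq0.
- by case: i j' => [|[|i]] [|[|j']].
- by case: eqP => [?|?]; [|case: eqP => [?|?]]; lia.
- by rewrite oner_neq0.
- by do 2![case: eqP => [?|?]; [|case: eqP => [?|?]]]; lia.
Qed.

Lemma letter_monomial_mx (R : realType) (d e m : nat) (l : letter) :
  letter_ok d e m l ->
  letter_mx R d e m.+1 l = monomial_mx m (letter_row R d e l).
Proof.
case: l => [|k|j] /andP[/= okl okm]; apply/matrixP=> x y; rewrite mxE.
- by rewrite !mxE /= -val_eqE /= (eq_sym (y : nat));
    case: (nat_of_ord x == nat_of_ord y).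
- case: m okm x y {okl} => // m _ x y.
  rewrite /t_mx /t_block !mxE.
  case: splitP => x1 ->; rewrite !mxE; case: splitP => y1 ->; rewrite !mxE ?ord1.
  + case: splitP => x2 ->; rewrite !mxE ord1; case: splitP => y2 ->;
    by rewrite !mxE !ord1 ?addn0 /= ?mulr1n.
  + by case: x1 => [[|[|?]]].
  + by case: y1 => [[|[|?]]].
  + by rewrite /= eq_sym eqn_add2l -val_eqE; case: eqP.
- have j2 : (inord j.-2 : 'I_m.+1) = j.-2 :> nat by rewrite inordK; lia.
  have j1 : (inord j.-1 : 'I_m.+1) = j.-1 :> nat by rewrite inordK; lia.
  rewrite /s_mx !mxE perm.permE -val_eqE /= -!(val_eqE x) /= j2 j1.
  by rewrite !(fun_if val) /= j1 j2 eq_sym; case: eqP.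
Qed.

Lemma word_row_cat (R : realType) (d e : nat) (u v : seq letter)
    (p : nat * R[i]) :
  word_row d e (u ++ v) p = word_row d e v (word_row d e u p).
Proof. exact: foldl_cat. Qed.

Lemma word_row_scale (R : realType) (d e : nat) (u : seq letter) (b : R[i])
    (p : nat * R[i]) :
  word_row d e u (scale_row b p) = scale_row b (word_row d e u p).
Proof.
elim: u p => //= l u IHu p; rewrite -IHu; congr word_row.
by rewrite /scale_row /= mulrA.
Qed.

Lemma word_rows_cons (R : realType) (d e : nat) (l : letter) (u : seq letter)
    (i : nat) :
  word_rows R d e (l :: u) i =
  comp_rows (letter_row R d e l) (word_rows R d e u) i.
Proof.
rewrite /word_rows /comp_rows -word_row_scale /=; congr word_row.
by rewrite /scale_row /= mul1r mulr1.
Qed.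

Lemma word_monomial_rows (R : realType) (d e m : nat) (u : seq letter) :
  (0 < d)%N -> (0 < e)%N -> all (letter_ok d e m) u ->
  monomial_rows m (word_rows R d e u).
Proof.
move=> d_gt0 e_gt0; elim: u => [_|l u IHu /= /andP[okl oku]].
  by split=> // i _; rewrite oner_neq0.
have l_mon := letter_monomial_rows R d_gt0 e_gt0 okl.
have [h1 h2 h3] := comp_monomial_rows l_mon (IHu oku).
by split=> [i|i|i j]; rewrite !word_rows_cons; [apply: h1|apply: h2|apply: h3].
Qed.

Lemma word_monomial_mx (R : realType) (d e m : nat) (u : seq letter) :
  (0 < d)%N -> (0 < e)%N -> all (letter_ok d e m) u ->
  \prod_(l <- u) letter_mx R d e m.+1 l = monomial_mx m (word_rows R d e u).
Proof.
move=> d_gt0 e_gt0; elim: u => [_|l u IHu /= /andP[okl oku]].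
  rewrite big_nil; apply/matrixP=> i j.
  by rewrite !mxE /= eq_sym -val_eqE; case: eqP.
rewrite big_cons IHu // letter_monomial_mx // -[LHS]/(_ *m _) mulmx_monomial.
  by apply: eq_monomial_mx => i _; rewrite word_rows_cons.
exact: letter_monomial_rows.
Qed.

(** Letters allowed in size m + 1 only move columns 0 to [m]. Hence the words produced for smaller
    matrices do not disturb the later rows. *)
Lemma word_row_fix (R : realType) (d e m x : nat) (u : seq letter) (a : R[i]) :
  all (letter_ok d e m) u -> (m < x)%N -> word_row d e u (x, a) = (x, a).
Proof.
move=> oku lt_mx; elim: u oku => //= l u IHu /andP[okl /IHu fixu].
rewrite (_ : scale_row _ _ = (x, a)) // /scale_row.
case: l okl => [|k|j] /andP[/= okl okm].
- by case: x lt_mx {IHu fixu} => // x _; rewrite mulr1.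
- by case: x lt_mx {IHu fixu} => [|[|x]] // lt_m; rewrite ?mulr1 //; lia.
- by rewrite mulr1; case: eqP => [?|_]; [|case: eqP => [?|//]]; lia.
Qed.

(** * Action and length of the words [RE_step] *)

Lemma s_letter_row (R : realType) (d e j x : nat) : (2 <= j)%N ->
  letter_row R d e (s_letter j) x =
  (if x == j.-2 then j.-1 else if x == j.-1 then j.-2 else x, 1).
Proof.
rewrite /s_letter; case: eqP => [-> _|//].
by case: x => [|[|x]] //=; rewrite expr0 ?invr1.
Qed.

Lemma s_up_rcons (a b : nat) : (a <= b.+1)%N ->
  s_up a b.+1 = rcons (s_up a b) (s_letter b.+1).
Proof.
move=> le_ab; rewrite /s_up /index_iota subSn // -[(_ - a).+1]addn1 iotaD.
by rewrite map_cat cats1 subnKC.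
Qed.

Lemma s_up_row (R : realType) (d e a b x : nat) (q : R[i]) : (a <= b)%N ->
  word_row d e (s_up a.+2 b.+1) (x, q) =
  (if x == a then b else if (a < x <= b)%N then x.-1 else x, q).
Proof.
move=> le_ab; rewrite -(subnKC le_ab); elim: (b - a)%N => [|k IHk].
  rewrite addn0 /s_up /index_iota subnn /=; congr pair.
  by case: ifP => [/eqP //|_]; case: ifP => //; lia.
rewrite addnS s_up_rcons ?ltnS ?leq_addr // -cats1 word_row_cat IHk /=.
rewrite s_letter_row // /scale_row /= mulr1; congr pair.
case: (x =P a) => xa; first by rewrite eqxx.
by do ?[case: ifP]; lia.
Qed.

Lemma s_down_row (R : realType) (d e a b x : nat) (q : R[i]) : (a <= b)%N ->
  word_row d e (s_down b.+1 a.+2) (x, q) =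
  (if x == b then a else if (a <= x < b)%N then x.+1 else x, q).
Proof.
move=> le_ab; rewrite -(subnKC le_ab) /s_down; elim: (b - a)%N x => [|k IHk] x.
  rewrite addn0 /s_up /index_iota subnn /=; congr pair.
  by case: ifP => [/eqP //|_]; case: ifP => //; lia.
rewrite addnS s_up_rcons ?ltnS ?leq_addr // rev_rcons /=.
rewrite s_letter_row // /scale_row /= mulr1 IHk; congr pair.
by do ?[case: ifP]; lia.
Qed.

Lemma size_s_up (a b : nat) : size (s_up a b) = (b.+1 - a)%N.
Proof. by rewrite size_map size_iota. Qed.

Lemma size_RE_step (R : realType) (d e i c : nat) (a : R[i]) :
  (2 <= i)%N -> (0 < c <= i)%N ->
  size (RE_step d e i c a) = if a == 1 then (i - c)%N else (i + c - 2)%N.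
Proof.
move=> i_ge2 c_i; rewrite /RE_step; case: eqP => _.
  by rewrite size_rev size_s_up subSS.
case: eqP => [->|c1]; first by rewrite size_cat size_rev size_s_up /=; lia.
case: eqP => [->|c2]; rewrite !size_cat size_rev !size_s_up /=; lia.
Qed.

(** On the rows other than the last, [bump] and the factor a^-1 in column 0 undo the renumbering and
    scaling of [reduce_row]. *)
Lemma RE_step_row (R : realType) (d e m c x : nat) (a q : R[i]) :
  (0 < d * e)%N -> a ^+ (d * e) = 1 -> (c <= m.+1)%N -> (x <= m.+1)%N ->
  word_row d e (RE_step d e m.+2 c.+1 a) (x, q) =
  if x == m.+1 then (c, a * q)
  else (bump c x, if x == 0%N then a^-1 * q else q).
Proof.
move=> de_gt0 a_de le_c le_x; rewrite /RE_step.
have [->|a_neq1] := eqVneq a 1.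
  rewrite s_down_row //.
  case: eqP => [_|ne]; first by rewrite mul1r.
  rewrite invr1 mul1r if_same /bump; congr pair.
  by case: ifP => ?; lia.
have zk := zeta_logK de_gt0 a_de.
(* With columns counted from 0, the cases are c = 0, c = 1 and c at least 2. In each, the decreasing
   word brings the last row to column 1 and t_k moves it to column 0 with coefficient [a]; then t_0
   brings it back to column 1 and the increasing word carries it on to [c], as far as needed. *)
case: c le_c => [|c] le_c /=; last have [->|c_neq0] := eqVneq c 0%N.
- rewrite word_row_cat s_down_row //.
  case: eqP => [_|ne]; first by rewrite /= /scale_row /= zk mulrC.
  case: x le_x ne => [|x] le_x ne /=;
    by rewrite ?ifT /= /scale_row /= ?zk ?mulr1 1?mulrC //; lia.
- rewrite word_row_cat s_down_row //.
  case: eqP => [_|ne]; first by rewrite /= /scale_row /= zk expr0 invr1 mulr1 mulrC.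
  case: x le_x ne => [|x] le_x ne /=; last first.
    by rewrite ifT /= /scale_row /= ?mulr1 //; lia.
  by rewrite /scale_row /= zk expr0 mulr1 mulrC.
- have -> : (c.+2 == 2) = false by lia.
  rewrite word_row_cat s_down_row //.
  rewrite /=; case: (x =P m.+1) => [_|ne] /=.
    by rewrite /scale_row /= zk expr0 invr1 mulr1 s_up_row // eqxx mulrC.
  case: x le_x ne => [|x] le_x ne /=.
    by rewrite /scale_row /= zk expr0 mulr1 s_up_row //= mulrC.
  rewrite ifT /=; last lia.
  rewrite /scale_row /= !mulr1 s_up_row // /bump; congr pair.
  by do ?[case: ifP]; lia.
Qed.

(** * The word RE(w) represents w *)

Lemma RE_rec_monomial (R : realType) (d e m : nat) (f : nat -> nat * R[i]) :
  monomial_rows m.+1 f ->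
  RE_rec d e (monomial_mx m.+1 f) =
  RE_rec d e (monomial_mx m (reduce_row (f m.+1) \o f)) ++
  RE_step d e m.+2 (f m.+1).1.+1 (f m.+1).2.
Proof.
by move=> f_mon; rewrite /= reduce_monomial_mx // last_row_col_monomial //
  monomial_mx_last.
Qed.

Lemma size_RE_rec (R : realType) (d e m : nat) (f : nat -> nat * R[i]) :
  monomial_rows m.+1 f ->
  size (RE_rec d e (monomial_mx m.+1 f)) =
  (size (RE_rec d e (monomial_mx m (reduce_row (f m.+1) \o f))) +
   if (f m.+1).2 == 1%R then m.+1 - (f m.+1).1 else m.+1 + (f m.+1).1)%N.
Proof.
move=> f_mon; rewrite RE_rec_monomial // size_cat size_RE_step //.
  by congr addn; case: eqP => _; lia.
exact: (rows_le f_mon (leqnn m.+1)).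
Qed.

Lemma letter_ok_s_up (d e m a b : nat) : (0 < d * e)%N -> (0 < m)%N ->
  (2 <= a)%N -> (b <= m.+1)%N -> all (letter_ok d e m) (s_up a b).
Proof.
move=> de_gt0 m_gt0 a_ge2 b_le; rewrite all_map; apply/allP => j.
rewrite mem_index_iota /= /s_letter => j_ab; case: eqP => j2.
  by rewrite /letter_ok /= de_gt0.
by rewrite /letter_ok /=; lia.
Qed.

Lemma letter_ok_RE_step (R : realType) (d e m c : nat) (a : R[i]) :
  (0 < d * e)%N -> (c <= m.+1)%N ->
  all (letter_ok d e m.+1) (RE_step d e m.+2 c.+1 a).
Proof.
move=> de_gt0 le_c; rewrite /RE_step /s_down.
have lt_log := zeta_log_lt a de_gt0.
case: ifP => _; first by rewrite all_rev letter_ok_s_up.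
have ok_t k : (k < d * e)%N -> letter_ok d e m.+1 (Lt k).
  by rewrite /letter_ok /= andbT.
case: ifP => _; [|case: ifP => _];
  by rewrite !all_cat all_rev ?letter_ok_s_up //= !ok_t.
Qed.

Lemma letter_okS (d e m : nat) (l : letter) :
  letter_ok d e m l -> letter_ok d e m.+1 l.
Proof. by case: l => [|k|j] /andP[/= ? ?]; rewrite /letter_ok /=; lia. Qed.

Lemma letter_ok_RE_rec (R : realType) (d e m : nat) (f : nat -> nat * R[i]) :
  (0 < d * e)%N -> monomial_rows m f ->
  all (letter_ok d e m) (RE_rec d e (monomial_mx m f)).
Proof.
move=> de_gt0; elim: m f => [|m IHm] f f_mon; first by rewrite /= all_nseq orbT.
rewrite RE_rec_monomial // all_cat letter_ok_RE_step ?(rows_le f_mon) // andbT.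
exact: (sub_all (@letter_okS d e m)) (IHm _ (reduce_monomial_rows f_mon)).
Qed.

Lemma word_row_nseq_z (R : realType) (d e k : nat) (a : R[i]) :
  word_row d e (nseq k Lz) (0%N, a) = (0%N, a * zeta R d ^+ k).
Proof.
elim: k a => [|k IHk] a; first by rewrite mulr1.
by rewrite /= /scale_row /= IHk exprS mulrA.
Qed.

Lemma RE_rec_rows (R : realType) (d e m : nat) (f : nat -> nat * R[i])
    (i : nat) :
  (0 < d)%N -> (0 < e)%N -> monomial_rows m f ->
  (forall i, (i <= m)%N -> (f i).2 ^+ (d * e) = 1) ->
  (\prod_(i < m.+1) (f i).2) ^+ d = 1 -> (i <= m)%N ->
  word_rows R d e (RE_rec d e (monomial_mx m f)) i = f i.
Proof.
move=> d_gt0 e_gt0; have de_gt0 : (0 < d * e)%N by rewrite muln_gt0 d_gt0.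
elim: m f i => [|m IHm] f i f_mon f_de f_d le_i.
  (* In size 1 the product is the only entry, hence a d-th root of unity, which is a power of
     zeta_d. *)
  move: le_i f_d; rewrite leqn0 big_ord1 => /eqP -> f_d.
  have := rows_le f_mon (leqnn 0); rewrite leqn0 => /eqP f0.
  rewrite /word_rows /= mxE f0 word_row_nseq_z zeta_logK // mul1r.
  by rewrite [RHS]surjective_pairing f0.
have g_mon := reduce_monomial_rows f_mon.
rewrite /word_rows RE_rec_monomial // word_row_cat.
have le_c := rows_le f_mon (leqnn m.+1).
move: le_i; rewrite leq_eqVlt => /predU1P[->|].
  (* The last basis vector is fixed by the word of the reduced matrix, so [RE_step] alone produces
     the last row. *)
  rewrite (word_row_fix _ (letter_ok_RE_rec de_gt0 g_mon)) //.
  by rewrite RE_step_row ?f_de // eqxx mulr1; case: (f m.+1).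
rewrite ltnS => le_i.
rewrite -/(word_rows R d e _ i) (IHm _ _ g_mon) //; first last.
- by have := f_d; rewrite -(prod_reduce_row f_mon).
- by move=> j le_j /=; case: ifP => _; rewrite ?exprMn ?f_de ?mulr1 // leqW.
have /eqP ne : (f i).1 != (f m.+1).1.
  apply/eqP => /(rows_inj f_mon (leqW le_i) (leqnn _)) eqi.
  by rewrite eqi ltnn in le_i.
rewrite /= [reduce_row _ _]surjective_pairing RE_step_row ?f_de //=; last first.
  exact: leqW (rows_le g_mon le_i).
rewrite ltn_eqF ?ltnS ?(rows_le g_mon le_i) // unbumpK ?inE; last by apply/eqP.
by case: eqP => _; rewrite ?mulKf ?(rows_neq0 f_mon) // -surjective_pairing.
Qed.

(** * Growth of the length under left multiplication by a letter *)

Lemma reduce_scale_row (K : fieldType) (p q : nat * K) (b : K) :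
  reduce_row p (scale_row b q) = scale_row b (reduce_row p q).
Proof. by rewrite /reduce_row /scale_row /=; case: ifP => // _; rewrite mulrCA. Qed.

Lemma scale_row1 (K : fieldType) (p : nat * K) : scale_row 1 p = p.
Proof. by case: p => c a; rewrite /scale_row mul1r. Qed.

Lemma size_RE_rec_zl (R : realType) (d e : nat) (f : nat -> nat * R[i]) :
  (0 < d)%N -> monomial_rows 0 f ->
  (size (RE_rec d e (monomial_mx 0 (comp_rows (letter_row R d e Lz) f))) <=
   (size (RE_rec d e (monomial_mx 0 f))).+1)%N.
Proof.
move=> d_gt0 f_mon; have := rows_le f_mon (leqnn 0); rewrite leqn0 => /eqP f0.
by rewrite /= !size_nseq !mxE /= f0 zeta_log_mulz.
Qed.

(** The inverse factors of t_k cancel in the product of the two entries, so RE_1 is unchanged. RE_2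
    has length 1 if the last row lies in the first column and 0 or 2 otherwise; exchanging the rows
    passes from one case to the other. *)
Lemma size_RE_rec_tl (R : realType) (d e k : nat) (f : nat -> nat * R[i]) :
  (0 < d)%N -> (0 < e)%N -> monomial_rows 1 f ->
  monomial_rows 1 (comp_rows (letter_row R d e (Lt k)) f) ->
  (size (RE_rec d e (monomial_mx 1 (comp_rows (letter_row R d e (Lt k)) f))) <=
   (size (RE_rec d e (monomial_mx 1 f))).+1)%N.
Proof.
move=> d_gt0 e_gt0 f_mon g_mon; rewrite !size_RE_rec //=.
have zk_neq0 : zeta R (d * e) ^+ k != 0.
  by rewrite expf_neq0 ?zeta_neq0 ?muln_gt0 ?d_gt0.
have le0 := rows_le f_mon (leq0n 1); have le1 := rows_le f_mon (leqnn 1).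
have ne : (f 0%N).1 <> (f 1%N).1 by move=> /(rows_inj f_mon) => /(_ isT isT).
rewrite !mxE /= /comp_rows /=.
case: (f 0%N) (f 1%N) le0 le1 ne => [c0 a0] [c1 a1] /=.
case: c0 c1 => [|[|c0]] [|[|c1]] //= _ _ _; rewrite /unbump /= !subn0 !subn1 /=.
- rewrite mulrACA mulfV // mul1r (mulrC a0) !size_nseq.
  by case: ifP => _; case: ifP => _; lia.
- rewrite mulrACA mulfV // mul1r (mulrC a0) !size_nseq.
  by case: ifP => _; case: ifP => _; lia.
Qed.

(** A removed coefficient is absorbed only in column 0, where the length of the step does not depend
    on the coefficient. So in both orders the columns count with the same signs, and only the larger
    one drops by 1 when processed second: the lengths differ by exactly 1. *)
Lemma size_RE_rec_swap (R : realType) (d e m : nat) (f g : nat -> nat * R[i]) :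
  monomial_rows m.+2 f -> monomial_rows m.+2 g ->
  g m.+2 = f m.+1 -> g m.+1 = f m.+2 -> (forall i, (i <= m)%N -> g i = f i) ->
  (size (RE_rec d e (monomial_mx m.+2 g)) <=
   (size (RE_rec d e (monomial_mx m.+2 f))).+1)%N.
Proof.
move=> f_mon g_mon g2 g1 g_lt.
rewrite !size_RE_rec //; try exact: reduce_monomial_rows.
rewrite /= g1 g2.
have ne : (f m.+1).1 <> (f m.+2).1.
  by move=> /(rows_inj f_mon (leqnSn _) (leqnn _)); lia.
set M := monomial_mx m _; set N := monomial_mx m _.
have -> : M = N.
  apply: eq_monomial_mx => i le_i /=; rewrite g_lt // reduce_rowC //.
    by move=> /(rows_inj f_mon (leqnSn _) (leqW (leqW le_i))); lia.
  by move=> /(rows_inj f_mon (leqnn _) (leqW (leqW le_i))); lia.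
have := rows_le f_mon (leqnn m.+2); have := rows_le f_mon (leqnSn m.+1).
move: (size _) ne => s; case: (f m.+1) (f m.+2) => [c a] [c' a'] /= ne le_c le_c'.
have ne' : c' <> c by move/esym.
rewrite !unbump_eq0 // (mulrC a' a) /unbump !(fun_if (eq_op^~ 1)).
(* The three tests may be taken as independent, since [w] is consulted only in column 0. *)
move: (a == 1) (a' == 1) (a * a' == 1) => u v w.
case: (boolP ((c' == 0%N) || _)) => h; case: (boolP ((c == 0%N) || _)) => h'.
all: by case: u v w => [] [] []; lia.
Qed.

(** A letter already allowed in the smaller size fixes the last row and commutes with reduction, so
    induction applies. The letters that first appear at the current size are treated directly. *)
Lemma size_RE_rec_letter (R : realType) (d e m : nat) (l : letter)
    (f : nat -> nat * R[i]) :
  (0 < d)%N -> (0 < e)%N -> letter_ok d e m l -> monomial_rows m f ->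
  (size (RE_rec d e (monomial_mx m (comp_rows (letter_row R d e l) f))) <=
   (size (RE_rec d e (monomial_mx m f))).+1)%N.
Proof.
move=> d_gt0 e_gt0; elim: m f => [|m IHm] f okl f_mon.
  case: l okl => [_|k /andP[]//|j /andP[/= ? _]]; last lia.
  exact: size_RE_rec_zl.
have g_mon := comp_monomial_rows (letter_monomial_rows R d_gt0 e_gt0 okl) f_mon.
have [okl'|nokl] := boolP (letter_ok d e m l).
  have gm : comp_rows (letter_row R d e l) f m.+1 = f m.+1.
    have := @word_row_fix R d e m m.+1 [:: l] 1.
    rewrite /= okl' => /(_ isT (ltnSn m)).
    rewrite /comp_rows /scale_row /= mul1r.
    by case=> -> ->; rewrite mul1r; case: (f _).
  rewrite !size_RE_rec // gm -addSn leq_add2r.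
  rewrite (_ : monomial_mx m (_ \o comp_rows _ f) = monomial_mx m
    (comp_rows (letter_row R d e l) (reduce_row (f m.+1) \o f))).
    exact: IHm (reduce_monomial_rows f_mon).
  by apply: eq_monomial_mx => i _; rewrite /= reduce_scale_row.
case: l okl nokl g_mon {IHm} => [|k|j] /andP[/= okl okm]; rewrite /letter_ok /=.
- by [].
- rewrite okl -eqn0Ngt => /eqP m0; rewrite m0 in f_mon * => g_mon.
  exact: size_RE_rec_tl.
- rewrite andbT => nokl g_mon.
  case: m f_mon g_mon okl nokl => [|m] f_mon g_mon okl nokl; first lia.
  (* The only transposition new to size m + 3 is the one exchanging the last two rows. *)
  have ej : j = m.+3 by lia.
  subst j; apply: size_RE_rec_swap => //.
  + rewrite /comp_rows /= eqxx scale_row1.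
    by case: eqP => [?|_]; [lia|].
  + by rewrite /comp_rows /= eqxx scale_row1.
  + move=> i le_i; rewrite /comp_rows /= scale_row1.
    by case: eqP => [?|_]; [lia|case: eqP => [?|_]; [lia|]].
Qed.

Lemma size_RE_rec1 (R : realType) (d e m : nat) : (0 < d)%N -> (0 < e)%N ->
  size (RE_rec d e (monomial_mx m (fun i => (i, 1 : R[i])))) = 0%N.
Proof.
move=> d_gt0 e_gt0; elim: m => [|m IHm].
  by rewrite /= size_nseq mxE /= -[1](expr0 (zeta R d)) zeta_log_expr.
(* The identity consists of the rows of the empty word, hence is monomial. *)
rewrite size_RE_rec; last exact: (word_monomial_rows R (u := [::]) d_gt0 e_gt0).
rewrite /= eqxx subnn addn0 -[RHS]IHm; congr (size (RE_rec _ _ _)).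
apply: eq_monomial_mx => i le_i; rewrite /= /reduce_row /= mul1r if_same /unbump.
by rewrite ltnNge leqW // subn0.
Qed.

Lemma size_RE_rec_word (R : realType) (d e m : nat) (u : seq letter) :
  (0 < d)%N -> (0 < e)%N -> all (letter_ok d e m) u ->
  (size (RE_rec d e (monomial_mx m (word_rows R d e u))) <= size u)%N.
Proof.
move=> d_gt0 e_gt0; elim: u => [_|l u IHu /= /andP[okl oku]].
  by rewrite size_RE_rec1.
rewrite (eq_monomial_mx (fun i _ => word_rows_cons R d e l u i)).
have u_mon := word_monomial_rows R d_gt0 e_gt0 oku.
apply: leq_trans (size_RE_rec_letter d_gt0 e_gt0 okl u_mon) _.
by rewrite ltnS IHu.
Qed.

(** * From matrices to rows, and conclusion *)

Lemma is_monomial_rows (K : fieldType) (m : nat) (w : 'M[K]_m.+1) :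
  is_monomial w -> exists2 f, monomial_rows m f & w = monomial_mx m f.
Proof.
move=> [w_row w_col].
(* The default is never taken, as every row has a nonzero entry. *)
pose c i := odflt ord0 [pick j | w (inord i) j != 0].
have w_c i : w (inord i) (c i) != 0.
  rewrite /c; case: pickP => //= w0; have [j [wj _]] := w_row (inord i).
  by rewrite w0 in wj.
have c_uniq i j : w (inord i) j != 0 -> j = c i.
  by have [k [_ k_uniq]] := w_row (inord i) => /k_uniq <-; apply: k_uniq.
exists (fun i => (val (c i), w (inord i) (c i))).
  split=> [i _|i _|i j le_i le_j /= /val_inj eq_c];
    [exact: (ltn_ord (c i))|exact: w_c|].
  have [k [_ k_uniq]] := w_col (c i).
  have := w_c j; rewrite -eq_c => /k_uniq.
  rewrite (k_uniq _ (w_c i)) => /(congr1 val).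
  by rewrite /= !inordK ?ltnS.
apply/matrixP=> i j; rewrite mxE /= inord_val.
case: eqP => [/val_inj ->|ne]; first by rewrite -[i in w i]inord_val.
have [->//|wij] := eqVneq (w i j) 0; case: ne; congr val; apply: c_uniq.
by rewrite inord_val.
Qed.

Theorem proposition3p14 (R : realType) (d e n : nat) (hd : (1 < d)%N)
    (he : (1 < e)%N) (hn : (2 <= n)%N) (w : 'M[R[i]]_n) (hw : in_G d e w) :
  reduced_expression d e (RE d e w) w.
Proof.
case: n hn w hw => [|[|m]] // _ w [w_mon w_de w_d].
have d_gt0 : (0 < d)%N by apply: ltnW.
have e_gt0 : (0 < e)%N by apply: ltnW.
have de_gt0 : (0 < d * e)%N by rewrite muln_gt0 d_gt0.
have [f f_mon wE] := is_monomial_rows w_mon.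
(* In size at least 2 no t_k has a dummy value. *)
have ok_alphabet l : letter_ok d e m.+1 l = alphabet d e m.+2 l.
  by case: l => [|k|j]; rewrite /letter_ok /= ?andbT.
have wf (i : 'I_m.+2) : (\prod_(j | w i j != 0) w i j) = (f i).2.
  have le_i : (i <= m.+1)%N by rewrite -ltnS.
  rewrite (big_pred1 (Ordinal (rows_le f_mon le_i : ((f i).1 < m.+2)%N))) => [|j].
    by rewrite wE mxE /= eqxx.
  rewrite wE mxE /= -val_eqE /=; case: ifP => _; rewrite ?eqxx //.
  by rewrite (rows_neq0 f_mon).
have f_de i : (i <= m.+1)%N -> (f i).2 ^+ (d * e) = 1.
  move=> le_i; apply/eqP; rewrite -unity_rootE.
  have := w_de (inord i) (inord (f i).1).
  rewrite wE mxE !inordK ?ltnS ?(rows_le f_mon) // eqxx; apply.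
  exact: (rows_neq0 f_mon le_i).
have f_d : (\prod_(i < m.+2) (f i).2) ^+ d = 1.
  by apply/eqP; rewrite -unity_rootE -(eq_bigr _ (fun i _ => wf i)).
have okRE := letter_ok_RE_rec de_gt0 f_mon.
have -> : RE d e w = RE_rec d e (monomial_mx m.+1 f) by rewrite wE.
rewrite wE; split; first split.
- by rewrite -(eq_all ok_alphabet).
- rewrite word_monomial_mx //; apply: eq_monomial_mx => i le_i.
  exact: (RE_rec_rows d_gt0 e_gt0 f_mon f_de f_d le_i).
(* The matrix is replaced by the product of [v], so RE is evaluated on the rows of [v] itself. *)
move=> v [okv <-]; rewrite -(eq_all ok_alphabet) in okv.
rewrite word_monomial_mx //.
exact: (size_RE_rec_word R d_gt0 e_gt0 okv).
Qed.
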